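(* Let $m\ge1$ be an integer. The $m+1$ operations $\prec,\circ_1,\dots,\circ_{m-1},\succ$ on ${}^m\mathbf{FQSym}$ obtained by splitting the shifted shuffle product of $m$-permutations according to right-to-left minima (as defined in the context) endow ${}^m\mathbf{FQSym}$ with the structure of an $m$-dendriform algebra.
   Context: All vector spaces are over a field $\mathbb{K}$ of characteristic $0$. **$m$-dendriform algebras.** An $m$-dendriform algebra is a vector space with $m+1$ binary bilinear operations $\prec,\circ_1,\dots,\circ_{m-1},\succ$ such that, with $*=\prec+\circ_1+\dots+\circ_{m-1}+\succ$, for all elements $u,v,w$ and all indices $1\le i,j,k\le m-1$: (1) $(u\prec v)\prec w=u\prec(v*w)$; (2) $(u\circ_i v)\prec w=u\circ_i(v\prec w)$ for all $i$; (3) $(u\succ v)\prec w=u\succ(v\prec w)$; (4) $(u\prec v)\circ_i w=u\circ_i\bigl(v\succ w+\sum_{j\ge i}v\circ_j w\bigr)$ for all $i$; (5) $(u*v)\succ w=u\succ(v\succ w)$; (6) $\bigl(u\succ v+\sum_{j\ge m-i}u\circ_j v\bigr)\circ_i w=u\succ(v\circ_i w)$ for all $i$; (7) $(u\circ_k v)\circ_i w=u\circ_{k+i}(v\circ_i w)$ if $k+i<m$. **The algebra ${}^m\mathbf{FQSym}$.** An $m$-permutation (of size $n\ge1$) is a word of length $mn$ in which each integer from $1$ to $n$ appears exactly $m$ times. ${}^m\mathbf{FQSym}$ has basis $(\mathbf{F}_\sigma)$ indexed by $m$-permutations, with product $\mathbf{F}_\sigma\mathbf{F}_\tau=\sum_\gamma\mathbf{F}_\gamma$,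 where $\gamma$ runs over the shifted shuffle of $\sigma$ and $\tau$: all shuffles of the word $\sigma$ with the word $\tau[\max\sigma]$ obtained by adding the maximal letter of $\sigma$ to each letter of $\tau$. **The operations.** For a word $\tau=\tau_1\cdots\tau_p$, a right-to-left minimum is a position $i\in[1,p]$ such that $\tau_j\ge\tau_i$ for all $j>i$; list these positions in decreasing order as $m_1(\tau)=p>m_2(\tau)>\cdots$ (an $m$-permutation has at least $m$ of them). Each of the following is the sum of the $\mathbf{F}_\gamma$ over those $\gamma$ in the shifted shuffle of $\sigma$ and $\tau$ in which the letter of $\gamma$ coming from the last letter of $\sigma$ is located - for $\mathbf{F}_\sigma\prec\mathbf{F}_\tau$: to the right of the letter coming from position $m_1(\tau)$ of $\tau$; - for $\mathbf{F}_\sigma\circ_i\mathbf{F}_\tau$ ($1\le i\le m-1$): between the letters coming from positions $m_{i+1}(\tau)$ and $m_i(\tau)$ of $\tau$; - for $\mathbf{F}_\sigma\succ\mathbf{F}_\tau$: to the left of the letter coming from position $m_m(\tau)$ of $\tau$. *)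

(* Defs.v *)
From HB Require Import structures.
From mathcomp Require Export all_boot all_order all_algebra.
From mathcomp Require Export finmap monalg.

Set Implicit Arguments.
Unset Strict Implicit.
Unset Printing Implicit Defensive.

Import GRing.Theory.
Local Open Scope ring_scope.

Section MDendriform.
Variables (K : fieldType) (V : lmodType K) (m : nat).
Variables (prec : V -> V -> V) (circ : nat -> V -> V -> V) (succ : V -> V -> V).

Definition mdend_star (u v : V) : V :=
  prec u v + \sum_(1 <= i < m) circ i u v + succ u v.

(* Only [circ 1, ..., circ m.-1] are operations of the structure: the values of
   [circ] at the other indices are junk, and are not constrained. *)
Record is_mdendriform : Prop := IsMDendriform {
  mdend_prec_bilinear : bilinear_for *:%R *:%R prec;
  mdend_circ_bilinear i : (1 <= i < m)%N -> bilinear_for *:%R *:%R (circ i);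
  mdend_succ_bilinear : bilinear_for *:%R *:%R succ;
  mdend_prec_prec u v w :
    prec (prec u v) w = prec u (mdend_star v w);
  mdend_circ_prec i u v w : (1 <= i < m)%N ->
    prec (circ i u v) w = circ i u (prec v w);
  mdend_succ_prec u v w :
    prec (succ u v) w = succ u (prec v w);
  mdend_prec_circ i u v w : (1 <= i < m)%N ->
    circ i (prec u v) w =
    circ i u (succ v w + \sum_(i <= j < m) circ j v w);
  mdend_star_succ u v w :
    succ (mdend_star u v) w = succ u (succ v w);
  mdend_succ_circ i u v w : (1 <= i < m)%N ->
    circ i (succ u v + \sum_(m - i <= j < m) circ j u v) w =
    succ u (circ i v w);
  mdend_circ_circ k i u v w :
      (1 <= k < m)%N -> (1 <= i < m)%N -> (k + i < m)%N ->
    circ i (circ k u v) w = circ (k + i) u (circ i v w)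
}.

End MDendriform.

Section Words.
Local Open Scope nat_scope.

Definition maxletter (w : seq nat) : nat := \max_(a <- w) a.

(* The size n of an m-permutation is its maximal letter: see [is_mpermP]. *)
Definition is_mperm (m : nat) (w : seq nat) : bool :=
  [&& 0 < maxletter w, size w == m * maxletter w
    & all (fun i => count_mem i w == m) (iota 1 (maxletter w))].

(* Shuffles are listed with multiplicity; those of words without common letters
   are pairwise distinct. *)
Fixpoint shuffle (s : seq nat) : seq nat -> seq (seq nat) :=
  if s isn't a :: s' then fun t => [:: t] else
  fix shuffle_s t :=
    if t isn't b :: t' then [:: s] else
    map (cons a) (shuffle s' t) ++ map (cons b) (shuffle_s t').

Definition shifted_shuffle (s t : seq nat) : seq (seq nat) :=
  shuffle s [seq maxletter s + b | b <- t].

(* Positions are counted from 0; [rlmin t k] is m_k(t), for 1 <= k. *)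
Definition rlminima (t : seq nat) : seq nat :=
  [seq i <- rev (iota 0 (size t)) | all (leq (nth 0 t i)) (drop i.+1 t)].

Definition rlmin (t : seq nat) (k : nat) : nat := nth 0 (rlminima t) k.-1.

(* In a shifted shuffle g of s and t, the letters coming from s are those that
   are at most [maxletter s], and those coming from t are the larger ones, in
   the same order as in s and t respectively. Hence [pos_left s g i] and
   [pos_right s g j] are the positions in g of the letters coming from
   position i of s and from position j of t. *)
Definition pos_left (s g : seq nat) (i : nat) : nat :=
  nth 0 [seq p <- iota 0 (size g) | nth 0 g p <= maxletter s] i.

Definition pos_right (s g : seq nat) (j : nat) : nat :=
  nth 0 [seq p <- iota 0 (size g) | maxletter s < nth 0 g p] j.

Definition pos_last (s g : seq nat) : nat := pos_left s g (size s).-1.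

Definition pos_rlmin (s t g : seq nat) (k : nat) : nat :=
  pos_right s g (rlmin t k).

Definition prec_cond (s t g : seq nat) : bool :=
  pos_rlmin s t g 1 < pos_last s g.

Definition circ_cond (i : nat) (s t g : seq nat) : bool :=
  pos_rlmin s t g i.+1 < pos_last s g < pos_rlmin s t g i.

Definition succ_cond (m : nat) (s t g : seq nat) : bool :=
  pos_last s g < pos_rlmin s t g m.

Lemma sum_count_mem (r w : seq nat) : uniq r ->
  \sum_(i <- r) count_mem i w = count (mem r) w.
Proof.
elim: r => [|a r IHr] /=; first by rewrite big_nil count_pred0.
case/andP=> ar /IHr; rewrite big_cons => ->.
rewrite -count_predUI [X in _ + X](_ : _ = 0) ?addn0.
  by apply: eq_count => x; rewrite /= inE.
by apply/eqP; rewrite -leqn0 leqNgt -has_count; apply/hasPn => x _ /=;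
   case: eqP => // ->.
Qed.

Lemma mperm_letters m n w : size w = m * n ->
  (forall i, 1 <= i <= n -> count_mem i w = m) ->
  all (fun a => 1 <= a <= n) w.
Proof.
move=> sw cw; have := sum_count_mem w (iota_uniq 1 n).
rewrite (eq_big_seq (fun=> m)) => [|i]; last first.
  by rewrite mem_iota add1n ltnS => /cw.
rewrite big_const_seq count_predT size_iota iter_addn_0 -sw => /esym/eqP.
rewrite -all_count => /allP hw; apply/allP => a /hw /=.
by rewrite mem_iota add1n ltnS.
Qed.

Lemma maxletter_leq w a : a \in w -> a <= maxletter w.
Proof. by move=> aw; rewrite /maxletter (big_rem a) //= leq_maxl. Qed.

Lemma is_mpermP m w : 0 < m ->
  reflect (exists n, [/\ 0 < n, size w = m * n
                       & forall i, 1 <= i <= n -> count_mem i w = m])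
          (is_mperm m w).
Proof.
move=> m0; apply: (iffP and3P) => [[n0 /eqP sw /allP cw]|[n [n0 sw cw]]].
  exists (maxletter w); split=> // i hi; apply/eqP/cw.
  by rewrite mem_iota add1n ltnS.
have wn : maxletter w = n.
  have /allP lw := mperm_letters sw cw.
  apply/eqP; rewrite eqn_leq; apply/andP; split.
    rewrite /maxletter big_seq; elim/big_ind: _ => // [x y|i /lw /andP[] //].
    by rewrite geq_max => -> ->.
  apply: maxletter_leq; rewrite -has_pred1 has_count cw //.
  by rewrite n0 leqnn.
rewrite wn sw eqxx; split=> //; apply/allP => i.
by rewrite mem_iota add1n ltnS => /cw ->.
Qed.

Lemma shuffle_perm s t g : g \in shuffle s t -> perm_eq g (s ++ t).
Proof.
elim: s t g => [|a s IHs] t g; first by rewrite inE => /eqP ->.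
elim: t g => [|b t IHt] g; first by rewrite inE cats0 => /eqP ->.
rewrite [shuffle _ _]/= mem_cat => /orP[] /mapP[h hh ->].
  by rewrite cat_cons perm_cons IHs.
by rewrite perm_sym -(cat1s b t) perm_catCA perm_cons perm_sym IHt.
Qed.

Lemma shifted_shuffle_mperm m s t :
  is_mperm m s -> is_mperm m t -> all (is_mperm m) (shifted_shuffle s t).
Proof.
have [->|m0] := posnP m.
  move=> /and3P[n0 /eqP sw _]; move: n0.
  by move/eqP: sw; rewrite mul0n size_eq0 => /eqP ->; rewrite /maxletter big_nil.
move=> hs ht; apply/allP => g /shuffle_perm hg.
have /and3P[n0 /eqP ss /allP cs] := hs; have /(is_mpermP _ m0)[n [_ st ct]] := ht.
apply/is_mpermP => //; exists (maxletter s + n); split.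
- by rewrite addn_gt0 n0.
- by rewrite (perm_size hg) size_cat size_map ss st mulnDr.
move=> i /andP[i0 hi]; rewrite (permP hg) count_cat count_map.
have [le_i|lt_i] := leqP i (maxletter s).
  rewrite (eqP (cs i _)) ?mem_iota ?i0 ?add1n ?ltnS //.
  rewrite [X in _ + X](_ : _ = 0) ?addn0 //.
  apply/eqP; rewrite -leqn0 leqNgt -has_count; apply/hasPn => b.
  have /allP lt := mperm_letters st ct; move=> /lt /andP[b0 _] /=.
  apply: contraL le_i => /eqP <-.
  by rewrite -ltnNge -[X in X < _]addn0 ltn_add2l.
rewrite [X in X + _](_ : _ = 0) ?add0n; last first.
  apply/eqP; rewrite -leqn0 leqNgt -has_count; apply/hasPn => a /maxletter_leq.
  by apply: contraTN => /= /eqP ->; rewrite -ltnNge.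
rewrite -(ct (i - maxletter s)); last by rewrite subn_gt0 lt_i leq_subLR.
apply: eq_count => b /=.
by rewrite -(eqn_add2l (maxletter s) b) subnKC // ltnW.
Qed.

Lemma size_positions (p : pred nat) (g : seq nat) :
  size [seq i <- iota 0 (size g) | p (nth 0 g i)] = count p g.
Proof.
by rewrite size_filter -[in RHS](mkseq_nth 0 g) /mkseq count_map.
Qed.

Lemma nth_positions (p : pred nat) (g : seq nat) k : k < count p g ->
  p (nth 0 g (nth 0 [seq i <- iota 0 (size g) | p (nth 0 g i)] k)).
Proof.
rewrite -size_positions => /(mem_nth 0).
by rewrite mem_filter => /andP[].
Qed.

Lemma ltn_positions (p : pred nat) (g : seq nat) j k : j < k < count p g ->
  nth 0 [seq i <- iota 0 (size g) | p (nth 0 g i)] j <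
  nth 0 [seq i <- iota 0 (size g) | p (nth 0 g i)] k.
Proof.
rewrite -size_positions => /andP[jk kn].
apply: (sorted_ltn_nth ltn_trans); rewrite ?inE //.
  by apply: sorted_filter; [exact: ltn_trans|exact: iota_ltn_sorted].
exact: ltn_trans kn.
Qed.

Lemma size_rlminima m t : is_mperm m t -> m <= size (rlminima t).
Proof.
case/and3P=> n0 /eqP st /allP ct.
have /eqP <- : count_mem 1 t == m by rewrite ct // mem_iota.
have lt : all (fun a => 1 <= a <= maxletter t) t.
  apply: (mperm_letters st) => i hi; apply/eqP/ct.
  by rewrite mem_iota add1n ltnS.
rewrite /rlminima size_filter count_rev -(size_positions (pred1 1)) size_filter.
apply: sub_count => i /= /eqP ->.
by apply/allP => b /mem_drop /(allP lt) /andP[].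
Qed.

Lemma rlmin_decr t k : 0 < k < size (rlminima t) -> rlmin t k.+1 < rlmin t k.
Proof.
case/andP; case: k => // k _ hk; rewrite /rlmin /=.
have gtn_trans : transitive gtn by move=> y x z /= yx zy; apply: ltn_trans yx.
apply: (sorted_ltn_nth gtn_trans); rewrite ?inE //; last exact: ltnW.
by apply: sorted_filter => //; rewrite rev_sorted iota_ltn_sorted.
Qed.

Lemma rlmin_lt t k : 0 < k <= size (rlminima t) -> rlmin t k < size t.
Proof.
case/andP; case: k => // k _ /(mem_nth 0).
by rewrite mem_filter mem_rev mem_iota => /and3P[].
Qed.

(* The conditions defining the m + 1 operations are exhaustive and mutually
   exclusive. *)
Lemma split_cond m s t g :
    0 < m -> is_mperm m s -> is_mperm m t -> g \in shifted_shuffle s t ->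
  prec_cond s t g + \sum_(1 <= i < m) circ_cond i s t g + succ_cond m s t g = 1.
Proof.
move=> m0 hs ht /shuffle_perm hg.
have [ns [ns0 ss cs]] := is_mpermP _ m0 hs.
have [nt [nt0 st ct]] := is_mpermP _ m0 ht.
have cleft : count (leq^~ (maxletter s)) g = size s.
  rewrite (permP hg) count_cat count_map.
  rewrite (_ : count _ s = size s); last first.
    by apply/eqP; rewrite -all_count; apply/allP => a /maxletter_leq.
  rewrite [X in _ + X](_ : _ = 0) ?addn0 //.
  apply/eqP; rewrite -leqn0 leqNgt -has_count; apply/hasPn => b.
  move=> /(allP (mperm_letters st ct)) /andP[b0 _] /=.
  by rewrite -ltnNge -[X in X < _]addn0 ltn_add2l.
have cright : count (ltn (maxletter s)) g = size t.
  have := count_predC (leq^~ (maxletter s)) g; rewrite cleft (perm_size hg).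
  rewrite size_cat size_map => /addnI <-.
  by apply: eq_count => a /=; rewrite ltnNge.
have lt_last : (size s).-1 < size s by rewrite prednK ss ?muln_gt0 ?m0.
have hm := size_rlminima ht.
have ney k : 0 < k <= m -> pos_last s g != pos_rlmin s t g k.
  case/andP=> k0 km; apply/eqP => e.
  have : nth 0 g (pos_last s g) <= maxletter s.
    by apply: (@nth_positions (leq^~ _)); rewrite cleft.
  rewrite e leqNgt => /negP; apply.
  apply: (@nth_positions (ltn _)); rewrite cright rlmin_lt // k0.
  exact: leq_trans hm.
have decr k : 0 < k < m -> pos_rlmin s t g k.+1 < pos_rlmin s t g k.
  case/andP=> k0 km; have kr := leq_trans km hm.
  apply: (@ltn_positions (ltn _)); rewrite cright.
  by rewrite rlmin_decr ?k0 // rlmin_lt // k0 ltnW.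
rewrite /prec_cond /circ_cond /succ_cond.
elim: m m0 {hs ht ss cs st ct hm} ney decr => // -[_|m IHm] _ ney decr.
  rewrite big_geq // addn0; have := ney 1 isT.
  by case: ltngtP.
rewrite big_nat_recr //= -[RHS](IHm isT) => [|k /andP[k0 km]|k /andP[k0 km]].
- rewrite -!addnA; congr (_ + (_ + _)).
  have := decr m.+1 (ltnSn _); have := ney m.+1; have := ney m.+2.
  rewrite !leqnn leqnSn /= => /(_ isT) + /(_ isT).
  case: (ltngtP (pos_last s g) (pos_rlmin s t g m.+1)) => //.
    by case: (ltngtP (pos_last s g) (pos_rlmin s t g m.+2)).
  by move=> h _ _ h'; rewrite (ltn_trans h' h) ltnNge (ltnW (ltn_trans h' h)).
- by apply: ney; rewrite k0 leqW.
- by apply: decr; rewrite k0 leqW.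
Qed.

End Words.

Record mperm (m : nat) := MPerm {
  mperm_word : seq nat;
  mperm_wordP : is_mperm m mperm_word
}.
HB.instance Definition _ (m : nat) := [isSub for @mperm_word m].
HB.instance Definition _ (m : nat) := [Choice of mperm m by <:].

Notation mFQSym K m := {malg K[mperm m]}.

Section MFQSym.
Variables (K : fieldType) (m : nat).

Definition Fbasis (s : mperm m) : mFQSym K m := << s >>.

Definition mperm_shuffle (s t : mperm m) : seq (mperm m) :=
  pmap insub (shifted_shuffle (val s) (val t)).

(* [insub] drops no word. *)
Lemma val_mperm_shuffle s t :
  map val (mperm_shuffle s t) = shifted_shuffle (val s) (val t).
Proof.
rewrite /mperm_shuffle pmap_filter; last exact: insubK.
rewrite (@eq_filter _ _ (is_mperm m)) => [|w].
  by apply/all_filterP/shifted_shuffle_mperm; apply: valP.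
by rewrite isSome_insub.
Qed.

(* The bilinear extension of
   (F_s, F_t) |-> sum of the F_g, for g in the shifted shuffle of s and t such
   that [cond s t g]. *)
Definition restricted_mul (cond : seq nat -> seq nat -> seq nat -> bool)
    (u v : mFQSym K m) : mFQSym K m :=
  \sum_(s <- msupp u) \sum_(t <- msupp v)
    (u@_s * v@_t) *:
      \sum_(g <- mperm_shuffle s t | cond (val s) (val t) (val g)) Fbasis g.

Definition mFQSym_mul := restricted_mul (fun _ _ _ => true).

Definition mFQSym_prec := restricted_mul prec_cond.
Definition mFQSym_circ (i : nat) := restricted_mul (circ_cond i).
Definition mFQSym_succ := restricted_mul (succ_cond m).

Lemma restricted_mul_basis cond s t :
  restricted_mul cond (Fbasis s) (Fbasis t) =
  \sum_(g <- mperm_shuffle s t | cond (val s) (val t) (val g)) Fbasis g.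
Proof.
rewrite /restricted_mul /Fbasis !msuppU oner_eq0 !big_seq_fset1.
by rewrite !mcoeffUU mul1r scale1r.
Qed.

Lemma mFQSym_split u v : (0 < m)%N ->
  mdend_star m mFQSym_prec mFQSym_circ mFQSym_succ u v = mFQSym_mul u v.
Proof.
move=> m0; pose F cond s t : mFQSym K m :=
  \sum_(g <- mperm_shuffle s t | cond (val s) (val t) (val g)) Fbasis g.
have FE s t : F (fun _ _ _ => true) s t =
    F prec_cond s t + \sum_(1 <= i < m) F (circ_cond i) s t
    + F (succ_cond m) s t.
  rewrite /F; under [X in _ + X + _]eq_bigr do rewrite big_mkcond.
  rewrite [X in _ = X + _ + _]big_mkcond [X in _ = _ + _ + X]big_mkcond.
  rewrite exchange_big -!big_split /= big_seq [RHS]big_seq.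
  apply: eq_bigr => g /(map_f val); rewrite val_mperm_shuffle => hg.
  rewrite -[LHS]mulr1n -[in LHS](split_cond m0 (valP s) (valP t) hg).
  rewrite !mulrnDr -sumrMnr.
  congr (_ + _ + _); last by case: ifP.
    by case: ifP.
  by apply: eq_bigr => i _; case: ifP.
rewrite /mdend_star exchange_big /= -!big_split; apply: eq_bigr => s _ /=.
rewrite exchange_big /= -!big_split; apply: eq_bigr => t _ /=.
rewrite -scaler_sumr -!scalerDr; congr (_ *: _); exact/esym/FE.
Qed.

End MFQSym.

(* Main.v *)
(**
  All letters of a shifted [t] exceed those of [s], so a right-to-left minimum
  of a shuffle [g] is either one of [t] lying to the right of the last letter of
  [s], or one of [s]. Hence each operation selects the [g] according to the
  number r of right-to-left minima of [g] whose letter comes from [t]: r = 0 for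
  [prec], r = i for [circ i], r >= m for [succ].

  Dually, the coefficient of an m-permutation x in a product u v is a sum over
  the cuts k, where u is evaluated on the letters <= k of x and v on the others.
  Two products with different bracketings are thus compared cut by cut, for two
  cuts k <= l: with p, q the numbers of right-to-left minima of x with letters
  in (k, l] and above l, and r the number of those with letters above l in the
  subword of letters > k, one has q <= r, and r = q unless p = 0 (a minimum in
  (k, l] is to the right of all letters <= k). Each axiom becomes an equivalence
  between conditions on (p, q) and on (r, p + q).
*)
Require Import Defs.
From mathcomp Require Import zify.

Set Implicit Arguments.
Unset Strict Implicit.
Unset Printing Implicit Defensive.

Import GRing.Theory.
Local Open Scope ring_scope.

Section Words.
Local Open Scope nat_scope.
Implicit Types (g h s t : seq nat) (i j k l n : nat).

(** * Cutting a word by letter values, and right-to-left minima above a cut *)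

Definition lower k g : seq nat := [seq a <- g | a <= k].

Arguments lower : simpl never.

Lemma lower_cons k a g :
  lower k (a :: g) = if a <= k then a :: lower k g else lower k g.
Proof. by []. Qed.

(** The subtraction undoes the shift made by [shifted_shuffle]. *)
Definition upper k g : seq nat := [seq a - k | a <- g & k < a].

Fixpoint rlm_above k g : nat :=
  if g is a :: g' then (k < a) && all (leq a) g' + rlm_above k g' else 0.

Lemma lower_lower k l g : k <= l -> lower k (lower l g) = lower k g.
Proof.
move=> kl; rewrite /lower -filter_predI; apply: eq_filter => a /=.
by lia.
Qed.

Lemma lower_upper j k g : lower j (upper k g) = upper k (lower (k + j) g).
Proof.
rewrite /lower /upper filter_map -!filter_predI; congr map.
by apply: eq_filter => a /=; lia.
Qed.

Lemma upper_upper j k g : upper j (upper k g) = upper (k + j) g.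
Proof.
rewrite /upper filter_map -filter_predI -map_comp.
rewrite (@eq_filter _ _ (fun a => k + j < a)) => [|a /=]; last by lia.
by apply: eq_map => a /=; lia.
Qed.

Lemma rlm_above_map_sub k l g : k <= l -> all (leq k) g ->
  rlm_above (l - k) [seq a - k | a <- g] = rlm_above l g.
Proof.
move=> kl; elim: g => //= a g IHg /andP[ka kg]; rewrite IHg //.
congr (_ && _ + _); first by lia.
rewrite all_map; apply: eq_in_all => b /(allP kg) /=; lia.
Qed.

Lemma rlm_above_upper k l g : k <= l ->
  rlm_above (l - k) (upper k g) = rlm_above l [seq a <- g | k < a].
Proof.
by move=> kl; apply: rlm_above_map_sub => //;
   apply/allP => a; rewrite mem_filter => /andP[/ltnW].
Qed.

Lemma all_leq_lower a l g : a <= l -> all (leq a) (lower l g) = all (leq a) g.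
Proof.
move=> al; rewrite all_filter; apply: eq_all => b /=; lia.
Qed.

(** Letters above l never prevent a letter <= l from being a minimum, so they can be deleted when
    the minima in (k, l] are counted. *)
Lemma rlm_above_split k l g : k <= l ->
  rlm_above k g = rlm_above k (lower l g) + rlm_above l g.
Proof.
move=> kl; elim: g => //= a g IHg; rewrite lower_cons; case: (leqP a l) => al /=.
  by rewrite IHg all_leq_lower //=; lia.
by rewrite IHg; lia.
Qed.

(** Deleting the letters <= k preserves the minima above l and may create new ones. *)
Lemma rlm_above_upper_geq k l g : k <= l ->
  rlm_above l g <= rlm_above (l - k) (upper k g).
Proof.
move=> kl; rewrite rlm_above_upper //; elim: g => //= a g IHg.
case: (ltnP k a) => ka /=; last by lia.
apply: leq_add => //; case: (l < a) => //=.
case: (boolP (all _ g)) => // ag; rewrite all_filter (sub_all _ ag) //.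
by move=> b /= ->; rewrite implybT.
Qed.

(** To the right of a minimum in (k, l] nothing is deleted, and to its left no letter above l can be
    a minimum, before or after the deletion. *)
Lemma rlm_above_upper_eq k l g : k <= l -> 0 < rlm_above k (lower l g) ->
  rlm_above (l - k) (upper k g) = rlm_above l g.
Proof.
move=> kl; rewrite rlm_above_upper //; elim: g => //= a g IHg.
rewrite lower_cons; have [al|la] := leqP a l; last first.
  move=> h; have ka := leq_ltn_trans kl la; rewrite ka /= la IHg //=.
  congr (nat_of_bool _ + _).
  rewrite all_filter; apply/idP/idP => [/allP ag|]; last first.
    by apply: sub_all => b /= ->; rewrite implybT.
  (* If all letters of [g] above k are at least a, hence above l, then none lies in (k, l], contrary
     to [h]. *)
  move: h; suff -> : rlm_above k (lower l g) = 0 by [].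
  have : all (geq k) (lower l g).
    apply/allP => b; rewrite mem_filter => /andP[bl /ag /=]; lia.
  elim: (lower l g) => //= b s IHs /andP[bk /IHs ->].
  by rewrite ltnNge bk.
have /negPf la : ~~ (l < a) by rewrite -leqNgt.
rewrite /= all_leq_lower //; case: (ltnP k a) => ka /=; last by rewrite !add0n.
rewrite la add0n; case: (boolP (all _ g)) => [ag _|_]; last by rewrite !add0n.
(* Here a is a minimum above k, so every letter of [g] exceeds k and is kept. *)
congr rlm_above; apply/all_filterP.
by apply: sub_all ag => b /=; apply: leq_trans.
Qed.

(** * Shuffles and the positions of right-to-left minima *)

Lemma count_mem_shuffle k s t g :
    all (geq k) s -> all (ltn k) t ->
  count_mem g (shuffle s t) = (lower k g == s) && ([seq a <- g | k < a] == t).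
Proof.
have ccons a L h : count_mem h (map (cons a) L) =
    if h is b :: h' then (a == b) * count_mem h' L else 0.
  rewrite count_map; case: h => [|b h].
    by rewrite (eq_count (a2 := pred0)) ?count_pred0.
  case: eqVneq => [->|ab]; last first.
    rewrite (eq_count (a2 := pred0)) ?count_pred0 // => x /=.
    by rewrite eqseq_cons (negPf ab).
  by rewrite mul1n; apply: eq_count => x /=; rewrite eqseq_cons eqxx.
have key1 g' : all (ltn k) g' = (lower k g' == [::]).
  rewrite -size_eq0 size_filter -leqn0 leqNgt -has_count -all_predC.
  by apply: eq_all => b /=; rewrite -ltnNge.
have key2 g' : all (geq k) g' = ([seq a <- g' | k < a] == [::]).
  rewrite -size_eq0 size_filter -leqn0 leqNgt -has_count -all_predC.
  by apply: eq_all => b /=; rewrite -leqNgt.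
elim: s t g => [|a s IHs] t g.
  move=> _ kt /=; rewrite addn0 -key1 eq_sym.
  congr nat_of_bool; apply/eqP/andP => [->|[/all_filterP -> /eqP //]].
  by split=> //; apply/eqP/all_filterP.
elim: t g => [|b t IHt] g ks kt.
  rewrite /= addn0 eq_sym -key2 andbC; congr nat_of_bool.
  apply/eqP/andP => [->|[gk /eqP <-]]; last by apply/esym/all_filterP.
  by split=> //; apply/eqP/all_filterP.
rewrite [shuffle _ _]/= count_cat !ccons; case: g => // c g.
have /andP[/= ak ks'] := ks; have /andP[/= kb kt'] := kt.
rewrite IHs // IHt //= lower_cons leqNgt.
case: (ltnP k c) => ck /=; rewrite !eqseq_cons.
  have -> : (a == c) = false by lia.
  by rewrite (eq_sym b); case: (c == b) => //=; rewrite ?andbF ?mul0n ?mul1n.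
have -> : (b == c) = false by lia.
by rewrite addn0 (eq_sym a); case: (c == a) => //=; rewrite ?mul0n ?mul1n.
Qed.

Lemma rlminima_cons a t : rlminima (a :: t) =
  map S (rlminima t) ++ (if all (leq a) t then [:: 0] else [::]).
Proof.
rewrite /rlminima /= rev_cons filter_rcons /= drop0.
rewrite (iotaDl 1 0) -map_rev filter_map.
rewrite (@eq_filter _ _ (fun i => all (leq (nth 0 t i)) (drop i.+1 t))) //.
by case: ifP => _; rewrite ?cats0 ?cats1.
Qed.

Lemma rlminima_addn k t : rlminima [seq k + b | b <- t] = rlminima t.
Proof.
elim: t => // a t IHt; rewrite map_cons !rlminima_cons IHt all_map.
by rewrite (@eq_all _ _ (leq a)) // => b /=; rewrite leq_add2l.
Qed.

Lemma nth_positions_cons (p : pred nat) a g i : i < count p g ->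
  nth 0 [seq q <- iota 0 (size (a :: g)) | p (nth 0 (a :: g) q)] (p a + i) =
  (nth 0 [seq q <- iota 0 (size g) | p (nth 0 g q)] i).+1.
Proof.
rewrite -size_positions => hi.
rewrite /= (iotaDl 1 0) filter_map; case: (p a) => /=; exact: nth_map.
Qed.

Lemma positionP (p : pred nat) g q : q < size g -> p (nth 0 g q) ->
  exists2 i, i < count p g &
    q = nth 0 [seq r <- iota 0 (size g) | p (nth 0 g r)] i.
Proof.
move=> hq pq.
have qin : q \in [seq r <- iota 0 (size g) | p (nth 0 g r)].
  by rewrite mem_filter pq mem_iota.
by rewrite -size_positions; exists (index q [seq r <- iota 0 (size g) | p (nth 0 g r)]);
  rewrite ?index_mem ?nth_index.
Qed.

Lemma position_lt_size (p : pred nat) g i : i < count p g ->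
  nth 0 [seq q <- iota 0 (size g) | p (nth 0 g q)] i < size g.
Proof.
rewrite -size_positions => /(mem_nth 0).
by rewrite mem_filter mem_iota => /and3P[].
Qed.

(** By the count hypothesis, [pos_last] is the rightmost position of a letter <= [maxletter s]. *)
Lemma pos_last_lt s g j : 0 < size s ->
    count (leq^~ (maxletter s)) g = size s -> j < count (ltn (maxletter s)) g ->
  (pos_last s g < pos_right s g j)
  = all (ltn (maxletter s)) (drop (pos_right s g j) g).
Proof.
move=> s0 cs hj; set k := maxletter s in cs hj *.
have hl : (size s).-1 < count (leq^~ k) g by rewrite cs prednK.
have gl : nth 0 g (pos_last s g) <= k := nth_positions hl.
have ll : pos_last s g < size g by apply: position_lt_size hl.
apply/idP/idP => [lt_last|/(all_nthP 0) h].
  apply/(all_nthP 0) => q; rewrite size_drop ltn_subRL nth_drop => hq.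
  rewrite /= ltnNge; apply/negP => gq.
  have [i hi eqi] := @positionP (leq^~ k) _ _ hq gq.
  have : i <= (size s).-1 by rewrite -ltnS prednK // -cs.
  rewrite leq_eqVlt => /orP[/eqP ei|ltil].
    by move: lt_last; rewrite /pos_last /pos_left -ei -eqi; lia.
  have : pos_right s g j + q < pos_last s g.
    by rewrite eqi; apply: (@ltn_positions (leq^~ k)); rewrite ltil.
  by rewrite ltnNge (leq_trans (ltnW lt_last)) // leq_addr.
rewrite ltnNge; apply/negP => hge.
have := h (pos_last s g - pos_right s g j).
rewrite size_drop ltn_sub2r //; last exact: leq_ltn_trans ll.
by rewrite nth_drop subnKC //= ltnNge gl => /(_ isT).
Qed.

(** Links the recursive count to positions: a letter above k is a minimum of [g] iff it is one among
    the letters above k and no letter <= k follows it. *)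
Lemma rlm_above_count s g (k := maxletter s) :
  rlm_above k g = count (fun j => all (ltn k) (drop (pos_right s g j) g))
                        (rlminima [seq a <- g | k < a]).
Proof.
rewrite /pos_right -/k; elim: g => //= a g IHg.
have ranged i : i \in rlminima [seq b <- g | k < b] -> i < count (ltn k) g.
  by rewrite mem_filter mem_rev mem_iota size_filter => /and3P[].
have := @nth_positions_cons (ltn k) a g; rewrite /=.
case: (ltnP k a) => ka hnth /=.
  rewrite rlminima_cons count_cat count_map IHg addnC; congr (_ + _).
    by apply: eq_in_count => i /ranged /hnth /= ->.
  case: (boolP (all (leq a) g)) => ag.
    have -> : all (leq a) [seq b <- g | k < b].
      by rewrite all_filter (sub_all _ ag) // => b /= ->; rewrite implybT.
    rewrite /= ka (sub_all _ ag) // => b /=; exact: leq_trans.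
  (* If a is a minimum only among the letters above k, some letter <= k follows it, so position 0 is
     not counted. *)
  case: ifP => //= hf; rewrite addn0 ka /=; case: (boolP (all (ltn k) g)) => // kg.
  by move: ag; rewrite -(all_filterP kg) hf.
by rewrite IHg; apply: eq_in_count => i /ranged /hnth /= ->.
Qed.

(** The pairwise hypothesis makes [p] hold exactly on an initial segment of [r], whose length is the
    count. *)
Lemma nth_sorted_count (T : Type) (p : pred T) x0 (r : seq T) i :
    pairwise (fun x y => p y ==> p x) r -> i < size r ->
  p (nth x0 r i) = (i < count p r).
Proof.
elim: r i => //= x r IHr i /andP[xr pr].
have [px|npx] := boolP (p x); first by case: i => //= i hi; rewrite IHr.
have c0 : count p r = 0.
  apply/eqP; rewrite -leqn0 leqNgt -has_count -all_predC.
  by apply: sub_all xr => y /=; rewrite (negPf npx) implybF.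
by case: i => [|i] hi /=; rewrite ?IHr // c0 ?(negPf npx).
Qed.

Lemma all_mperm_pos m t : is_mperm m t -> all (ltn 0) t.
Proof.
move=> ht; have m0 : 0 < m.
  case: m ht => // /and3P[+ /eqP]; rewrite mul0n => + /size0nil t0.
  by rewrite t0 /maxletter big_nil.
have [n [_ st ct]] := is_mpermP t m0 ht.
by apply: sub_all (mperm_letters st ct) => a /andP[].
Qed.

Lemma map_addn_upper k g : [seq k + b | b <- upper k g] = [seq a <- g | k < a].
Proof.
rewrite /upper -map_comp -[RHS]map_id; apply/eq_in_map => b.
by rewrite mem_filter => /andP[/ltnW kb _] /=; rewrite subnKC.
Qed.

Lemma count_mem_shifted_shuffle s t g (k := maxletter s) : all (ltn 0) t ->
  count_mem g (shifted_shuffle s t) = (lower k g == s) && (upper k g == t).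
Proof.
move=> t0; rewrite /shifted_shuffle (@count_mem_shuffle k).
- congr (nat_of_bool (_ && _)); apply/eqP/eqP => [|<-].
    rewrite /upper => ->; rewrite -map_comp -[RHS]map_id.
    by apply: eq_map => b /=; rewrite addKn.
  by rewrite map_addn_upper.
- by apply/allP => a /maxletter_leq.
- rewrite all_map; apply: sub_all t0 => b /=; rewrite -/k; lia.
Qed.

(** Having only letters from t onwards persists when moving right. Along the decreasing list of
    minima of t it thus holds on an initial segment, of length [rlm_above]. *)
Lemma pos_last_lt_rlmin m s t g j :
    is_mperm m s -> is_mperm m t -> g \in shifted_shuffle s t -> 0 < j <= m ->
  (pos_last s g < pos_rlmin s t g j) = (j <= rlm_above (maxletter s) g).
Proof.
move=> hs ht; rewrite -has_pred1 has_count.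
rewrite count_mem_shifted_shuffle ?(all_mperm_pos ht) //.
set k := maxletter s; case: andP => // -[/eqP gs /eqP gt] _ /andP[j0 jm].
have rt : rlminima [seq a <- g | k < a] = rlminima t.
  by rewrite -map_addn_upper rlminima_addn gt.
have ct : count (ltn k) g = size t by rewrite -gt size_map size_filter.
have cs : count (leq^~ k) g = size s by rewrite -gs size_filter.
have s0 : 0 < size s.
  have /and3P[] := hs; rewrite -/k => k0 /eqP -> _.
  by rewrite muln_gt0 k0 (leq_trans j0 jm).
have jr := leq_trans jm (size_rlminima ht).
rewrite /pos_rlmin pos_last_lt //; last by rewrite ct rlmin_lt // j0.
rewrite rlm_above_count rt /rlmin -[j in RHS]prednK //.
apply: (@nth_sorted_count _ (fun i => all _ (drop (pos_right s g i) g)));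
  last by rewrite prednK.
have decr : pairwise gtn (rlminima t).
  rewrite -sorted_pairwise; last by move=> y x z /= yx zy; apply: ltn_trans yx.
  apply: sorted_filter; first by move=> y x z /= yx zy; apply: ltn_trans yx.
  by rewrite rev_sorted iota_ltn_sorted.
apply: (sub_in_pairwise (P := gtn (size t))) decr => [x y|].
  rewrite !inE => xt yt /= yx; apply/implyP => /allP h; apply/allP => b.
  have : pos_right s g y < pos_right s g x.
    by apply: (@ltn_positions (ltn k)); rewrite yx ct.
  by move/ltnW/subnK => <-; rewrite -drop_drop => /mem_drop /h.
by apply/allP => i; rewrite mem_filter mem_rev mem_iota => /and3P[].
Qed.

Lemma pos_last_neq_rlmin m s t g j :
    is_mperm m s -> is_mperm m t -> g \in shifted_shuffle s t -> 0 < j <= m ->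
  pos_last s g != pos_rlmin s t g j.
Proof.
move=> hs ht; rewrite -has_pred1 has_count.
rewrite count_mem_shifted_shuffle ?(all_mperm_pos ht) //.
set k := maxletter s; case: andP => // -[/eqP gs /eqP gt] _ /andP[j0 jm].
have ct : count (ltn k) g = size t by rewrite -gt size_map size_filter.
have s0 : 0 < size s.
  have /and3P[] := hs; rewrite -/k => k0 /eqP -> _.
  by rewrite muln_gt0 k0 (leq_trans j0 jm).
apply/eqP => e; have : nth 0 g (pos_last s g) <= k.
  by apply: (@nth_positions (leq^~ k)); rewrite -size_filter [filter _ _]gs prednK.
rewrite e leqNgt => /negP; apply; apply: (@nth_positions (ltn k)).
by rewrite ct rlmin_lt // j0 (leq_trans jm) // size_rlminima.
Qed.

(** * The operations as selections by the number of minima above the cut *)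

Definition cond_spec m (cond : seq nat -> seq nat -> seq nat -> bool)
    (P : pred nat) :=
  forall s t g, is_mperm m s -> is_mperm m t -> g \in shifted_shuffle s t ->
  cond s t g = P (rlm_above (maxletter s) g).

Lemma prec_cond_spec m : 0 < m -> cond_spec m prec_cond (pred1 0).
Proof.
move=> m0 s t g hs ht hg; rewrite /prec_cond ltnNge leq_eqVlt.
have j1 : 0 < 1 <= m by [].
rewrite (negPf (pos_last_neq_rlmin hs ht hg j1)).
by rewrite (pos_last_lt_rlmin hs ht hg j1) /= lt0n negbK.
Qed.

Lemma circ_cond_spec m i : 1 <= i < m -> cond_spec m (circ_cond i) (pred1 i).
Proof.
move=> him s t g hs ht hg; rewrite /circ_cond ltnNge leq_eqVlt.
have ji : 0 < i <= m by lia.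
have ji1 : 0 < i.+1 <= m by lia.
rewrite (negPf (pos_last_neq_rlmin hs ht hg ji1)) /=.
rewrite (pos_last_lt_rlmin hs ht hg ji1) (pos_last_lt_rlmin hs ht hg ji) /=; lia.
Qed.

Lemma succ_cond_spec m : 0 < m -> cond_spec m (succ_cond m) (leq m).
Proof.
by move=> m0 s t g hs ht hg; rewrite /succ_cond (pos_last_lt_rlmin hs) // m0 /=.
Qed.

(* The union of the conditions defining [succ] and the [circ j], i <= j < m. *)
Definition tail_cond i s t g := pos_last s g < pos_rlmin s t g i.

Lemma tail_cond_spec m i : 0 < i <= m -> cond_spec m (tail_cond i) (leq i).
Proof.
by move=> him s t g hs ht hg; rewrite /tail_cond (pos_last_lt_rlmin hs).
Qed.

(** Unlike [is_mperm], this allows n = 0, so both parts of a cut, possibly empty, are covered. *)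
Definition balanced m n w := forall i, count_mem i w = m * (0 < i <= n).

Lemma balanced_is_mperm m w : is_mperm m w -> balanced m (maxletter w) w.
Proof.
move=> hw i; have /and3P[n0 _ /allP cw] := hw.
case: (boolP (0 < i <= _)) => hi; first by rewrite muln1 (eqP (cw i _)) // mem_iota; lia.
rewrite muln0; apply/eqP; rewrite -leqn0 leqNgt -has_count has_pred1.
apply: contra hi => iw; rewrite maxletter_leq // andbT.
exact: (allP (all_mperm_pos hw)).
Qed.

Section Balanced.
Variables (m n : nat) (w : seq nat).
Hypotheses (m0 : 0 < m) (bw : balanced m n w).

Lemma balanced_mem i : (i \in w) = (0 < i <= n).
Proof. by rewrite -has_pred1 has_count bw muln_gt0 m0 lt0b. Qed.

Lemma balanced_maxletter : maxletter w = n.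
Proof.
apply/eqP; rewrite eqn_leq; apply/andP; split.
  rewrite /maxletter big_seq; elim/big_ind: _ => // [x y|i].
    by rewrite geq_max => -> ->.
  by rewrite balanced_mem => /andP[].
have [->//|n0] := posnP n.
by apply: maxletter_leq; rewrite balanced_mem n0 leqnn.
Qed.

Lemma is_mperm_balanced : is_mperm m w = (0 < n).
Proof.
apply/idP/idP => [/and3P[]|n0]; first by rewrite balanced_maxletter.
have cw i : 0 < i <= n -> count_mem i w = m by move=> hi; rewrite bw hi muln1.
apply/is_mpermP => //; exists n; split=> //.
have := sum_count_mem w (iota_uniq 1 n).
rewrite (eq_big_seq (fun=> m)) => [|i]; last first.
  by rewrite mem_iota add1n ltnS => /cw.
rewrite big_const_seq count_predT size_iota iter_addn_0 => ->.
apply/esym/eqP; rewrite -all_count; apply/allP => a.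
by rewrite balanced_mem inE mem_iota add1n ltnS.
Qed.

Lemma balanced_lower k : k <= n -> balanced m k (lower k w).
Proof.
move=> kn i; rewrite count_filter; have [ik|ki] := leqP i k.
  rewrite (@eq_count _ _ (pred1 i)) => [|a /=]; last by case: eqP => // ->.
  by rewrite bw; congr (_ * _); lia.
rewrite (@eq_count _ _ pred0) => [|a /=]; last by lia.
by rewrite count_pred0 andbF muln0.
Qed.

Lemma balanced_upper k : balanced m (n - k) (upper k w).
Proof.
move=> i; rewrite count_map count_filter; have [->|i0] := posnP i.
  rewrite (@eq_count _ _ pred0) => [|a /=]; last by lia.
  by rewrite count_pred0 muln0.
rewrite (@eq_count _ _ (pred1 (k + i))) => [|a /=]; last by lia.
by rewrite bw; congr (_ * _); lia.
Qed.

End Balanced.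

End Words.

(** * Coefficients of products as sums over cuts *)

Section WordCoefficients.
Variables (K : fieldType) (m : nat).
Implicit Types (u v w : mFQSym K m) (h s t : mperm m) (P Q : pred nat).
Implicit Types (c d : seq nat -> seq nat -> seq nat -> bool).

(** Extended by 0 to all words, so that the empty parts of the extreme cuts contribute nothing. *)
Definition wcoef u (x : seq nat) : K := oapp (mcoeff^~ u) 0 (insub x).

Lemma wcoef_val u h : wcoef u (val h) = u@_h.
Proof. by rewrite /wcoef valK. Qed.

Lemma wcoef_out u x : ~~ is_mperm m x -> wcoef u x = 0.
Proof. by move=> hx; rewrite /wcoef insubN. Qed.

Lemma wcoefP a u v x : wcoef (a *: u + v) x = a * wcoef u x + wcoef v x.
Proof.
rewrite /wcoef; case: insub => [h|] /=; last by rewrite mulr0 addr0.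
by rewrite mcoeffD mcoeffZ.
Qed.

Lemma wcoef_sum u x : wcoef u x = \sum_(s <- msupp u) u@_s *+ (val s == x).
Proof.
rewrite /wcoef; case: insubP => [h _ <-|hx] /=; last first.
  rewrite big1 // => s _; case: eqP => // sx.
  by move: hx; rewrite -sx (valP s).
rewrite (eq_bigr (fun s => if s == h then u@_s else 0)) => [|s _]; last first.
  by rewrite val_eqE; case: eqP.
rewrite -big_mkcond; have [hu|hu] := boolP (h \in msupp u).
  by rewrite -big_filter filter_pred1_uniq ?big_seq1 // fset_uniq.
rewrite mcoeff_outdom // big1_seq // => s /andP[/eqP -> hs].
by rewrite hs in hu.
Qed.

Lemma mcoeff_restricted_shuffle c P s t h (k := maxletter (val s)) :
    cond_spec m c P ->
  (\sum_(g <- mperm_shuffle s t | c (val s) (val t) (val g)) Fbasis K g)@_h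
  = ([&& lower k (val h) == val s, upper k (val h) == val t
       & P (rlm_above k (val h))])%:R.
Proof.
move=> hc; rewrite raddf_sum big_mkcond /=.
rewrite (eq_bigr (fun g =>
  if g == h then (c (val s) (val t) (val h))%:R else 0)) => [|g _]; last first.
  by rewrite mcoeffU; case: eqP => [->|_]; case: (c _ _ _).
rewrite -big_mkcond big_const_seq iter_addr_0 -/(count_mem h _).
have -> : count_mem h (mperm_shuffle s t)
    = count_mem (val h) (shifted_shuffle (val s) (val t)).
  by rewrite -val_mperm_shuffle count_map; apply: eq_count => g /=; rewrite val_eqE.
have pt := all_mperm_pos (valP t).
have hg : val h \in shifted_shuffle (val s) (val t) ->
    c (val s) (val t) (val h) = P (rlm_above k (val h)).
  by apply: hc; apply: valP.
move: hg; rewrite -has_pred1 has_count count_mem_shifted_shuffle // andbA.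
by case: andP => // _ ->.
Qed.

(** After expansion over the supports, a pair (s, t) can contribute only at the cut k =
    [maxletter s], where s and t must be the two parts of h. *)
Lemma mcoeff_restricted_mul c P u v h : (0 < m)%N -> cond_spec m c P ->
  (restricted_mul c u v)@_h =
  \sum_(0 <= k < (maxletter (val h)).+1)
    (wcoef u (lower k (val h)) * wcoef v (upper k (val h)))
      *+ P (rlm_above k (val h)).
Proof.
move=> m0 hc; pose n := maxletter (val h).
have bh := balanced_is_mperm (valP h).
under [RHS]eq_bigr => k _.
  rewrite !wcoef_sum big_distrlr /= -sumrMnl.
  under eq_bigr => s _ do rewrite -sumrMnl.
  over.
rewrite exchange_big raddf_sum; apply: eq_bigr => s _.
rewrite exchange_big raddf_sum; apply: eq_bigr => t _ /=.
rewrite mcoeffZ (mcoeff_restricted_shuffle _ _ _ hc).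
set k0 := maxletter (val s).
rewrite (eq_big_nat _ _ (F2 := fun k => if k == k0 then
   u@_s * v@_t * ([&& lower k0 (val h) == val s, upper k0 (val h) == val t
       & P (rlm_above k0 (val h))])%:R else 0)) => [|k]; last first.
  rewrite ltnS => /andP[_ kn]; have bl := balanced_lower m0 bh kn.
  rewrite ![_ == val _]eq_sym; case: (eqVneq k k0) => [->|kk0].
    by do 2?[case: eqP => _]; case: (P _);
      rewrite ?mulr0n ?mulr1n ?mul0r ?mulr0 ?mulr1.
  case: eqP => [es|_]; last by rewrite mulr0n mul0r mul0rn.
  by case/eqP: kk0; rewrite -(balanced_maxletter m0 bl) -es.
rewrite -big_mkcond big_nat1_eq /= ltnS; case: leqP => // lt_k0.
(* Here [k0] exceeds every letter of h, so s cannot be the lower part of h. *)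
case: eqP => [es|_]; last by rewrite mulr0.
suff : (k0 <= n)%N by rewrite leqNgt lt_k0.
rewrite (_ : k0 = maxletter (lower k0 (val h))); last by rewrite es.
rewrite /maxletter /lower big_filter; apply/bigmax_leqP_seq => a ah _.
exact: maxletter_leq.
Qed.

Lemma wcoef_restricted_mul c P u v n x :
    (0 < m)%N -> cond_spec m c P -> balanced m n x ->
  wcoef (restricted_mul c u v) x =
  \sum_(0 <= k < n.+1)
    (wcoef u (lower k x) * wcoef v (upper k x)) *+ P (rlm_above k x).
Proof.
move=> m0 hc bx; have mx := is_mperm_balanced m0 bx.
have [n0|n0] := posnP n; last first.
  rewrite n0 in mx; rewrite -(balanced_maxletter m0 bx).
  have -> : x = val (MPerm mx) by [].
  by rewrite wcoef_val (mcoeff_restricted_mul _ _ _ m0 hc).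
(* For n = 0 the word is not an m-permutation, and both sides vanish. *)
rewrite n0 in mx bx *; rewrite big_nat1 wcoef_out ?mx //.
rewrite [wcoef u _]wcoef_out ?mul0r ?mul0rn //.
by rewrite (is_mperm_balanced m0 (balanced_lower m0 bx (leqnn 0))).
Qed.

Lemma bilinear_restricted_mul c P : (0 < m)%N -> cond_spec m c P ->
  bilinear_for *:%R *:%R (@restricted_mul K m c).
Proof.
move=> m0 hc; have coefE u v h := mcoeff_restricted_mul u v h m0 hc.
split=> u a v w; apply/malgP => h /=;
  rewrite [RHS]mcoeffD [X in _ = X + _]mcoeffZ [LHS]coefE;
  rewrite [X in _ = _ * X + _]coefE [X in _ = _ + X]coefE mulr_sumr -big_split;
  apply: eq_bigr => k _ /=; rewrite wcoefP.
  by rewrite mulrDl mulrnDl mulrnAr mulrA.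
by rewrite mulrDr mulrnDl mulrnAr mulrCA.
Qed.

(** Both sides are sums over k <= l of the same triple products, so only the selections have to
    agree. The constraints on p, q, r come from [rlm_above_upper_geq] and [rlm_above_upper_eq]. *)
Lemma restricted_mul_assoc c d c' d' P Q P' Q' u v w :
    (0 < m)%N -> cond_spec m c P -> cond_spec m d Q ->
    cond_spec m c' P' -> cond_spec m d' Q' ->
    (forall p q r : nat, (q <= r)%N -> p = 0%N \/ r = q ->
       P p && Q q = P' r && Q' (p + q)%N) ->
  restricted_mul d (restricted_mul c u v) w =
  restricted_mul d' u (restricted_mul c' v w).
Proof.
move=> m0 hc hd hc' hd' PQ; apply/malgP => h.
rewrite [LHS](mcoeff_restricted_mul _ _ h m0 hd).
rewrite [RHS](mcoeff_restricted_mul _ _ h m0 hd').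
have bx := balanced_is_mperm (valP h).
set x := val h in bx *; set n := maxletter x in bx *.
pose F k l := (wcoef u (lower k x) * wcoef v (upper k (lower l x))
  * wcoef w (upper l x)) *+ (P (rlm_above k (lower l x)) && Q (rlm_above l x)).
transitivity (\sum_(0 <= l < n.+1) \sum_(0 <= k < n.+1 | (k <= l)%N) F k l).
  apply: eq_big_nat => l; rewrite ltnS => ln; have bl := balanced_lower m0 bx ln.
  rewrite (wcoef_restricted_mul _ _ m0 hc bl) mulr_suml -sumrMnl.
  rewrite (big_nat_widen _ _ n.+1 xpredT) //; apply: eq_big => //= k; rewrite ltnS => kl.
  rewrite lower_lower // /F; case: (P _); case: (Q _); rewrite /= ?mulr0n ?mulr1n ?mul0r //.
(* The left bracketing cuts at l first, the right one at k first. *)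
rewrite (exchange_big_dep xpredT) //=; apply: eq_big_nat => k; rewrite ltnS => kn.
rewrite (wcoef_restricted_mul _ _ m0 hc' (balanced_upper m0 bx k)).
transitivity (\sum_(k <= l < n.+1) F k l).
  by rewrite (big_nat_widenl k 0%N).
(* After the shift by k, the cut l becomes the cut j = l - k of [upper k x]. *)
rewrite -{1}[k]add0n big_addn subSn // mulr_sumr -sumrMnl.
apply: eq_bigr => j _; rewrite /F.
have kj : (k <= j + k)%N by rewrite leq_addl.
have := PQ (rlm_above k (lower (j + k) x)) (rlm_above (j + k) x)
  (rlm_above j (upper k x)).
rewrite -(rlm_above_split x kj) => -> //.
- rewrite lower_upper upper_upper (addnC k j).
  by case: (P' _); case: (Q' _); rewrite /= ?mulr0n ?mulr1n ?mulr0 ?mulrA.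
- by have := rlm_above_upper_geq x kj; rewrite addnK.
- have := @rlm_above_upper_eq k (j + k) x kj; rewrite addnK.
  by case: posnP => [|_ /(_ isT)]; [left | right].
Qed.

(** Merges the sums in axioms (4) and (6) into one selection r >= i, as [restricted_mul_assoc]
    requires: r >= m comes from [succ], and each r in [i, m) from exactly one [circ]. *)
Lemma succ_circ_tail i u v : (0 < i <= m)%N ->
  mFQSym_succ u v + \sum_(i <= j < m) mFQSym_circ j u v =
  restricted_mul (tail_cond i) u v.
Proof.
move=> him; have m0 : (0 < m)%N by lia.
apply/malgP => h; rewrite [LHS]mcoeffD [X in _ + X = _]raddf_sum.
rewrite [X in X + _ = _](mcoeff_restricted_mul _ _ _ m0 (succ_cond_spec m0)).
rewrite [RHS](mcoeff_restricted_mul _ _ _ m0 (tail_cond_spec him)).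
have ij j : (i <= j < m)%N -> (1 <= j < m)%N by lia.
have circE j hj := mcoeff_restricted_mul u v h m0 (circ_cond_spec (ij j hj)).
rewrite (eq_big_nat _ _ circE) exchange_big -big_split.
apply: eq_bigr => k _ /=; rewrite sumrMnr -mulrnDr; congr (_ *+ _).
move: (rlm_above _ _) => r.
have [mr|rm] := leqP m r.
  rewrite big_nat big1 => [|j]; lia.
rewrite (eq_bigr (fun j => if j == r then 1 else 0)%N) => [|j _]; last first.
  by rewrite eq_sym; case: eqP.
by rewrite -big_mkcond big_nat1_eq rm andbT; case: leqP.
Qed.

End WordCoefficients.

(** * The axioms, reduced to arithmetic on p, q, r *)

Theorem mainTheorem2 (K : fieldType) (hK : [pchar K] =i pred0)
    (m : nat) (hm : (1 <= m)%N) :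
  is_mdendriform m (@mFQSym_prec K m) (@mFQSym_circ K m) (@mFQSym_succ K m).
Proof.
have hp := prec_cond_spec hm; have hs := succ_cond_spec hm.
have hc i (hi : (1 <= i < m)%N) := circ_cond_spec hi.
have ht : cond_spec m (fun _ _ _ => true) xpredT by [].
have star u v := @mFQSym_split K m u v hm.
split.
- exact: bilinear_restricted_mul hm hp.
- by move=> i hi; apply: bilinear_restricted_mul hm (hc i hi).
- exact: bilinear_restricted_mul hm hs.
(* The total operation is the selection [xpredT]; what remains is p = q = 0 iff p + q = 0. *)
- move=> u v w; rewrite star.
  by apply: (restricted_mul_assoc _ _ _ hm hp hp ht hp) => p q r /=; lia.
- move=> i u v w hi.
  by apply: (restricted_mul_assoc _ _ _ hm (hc i hi) hp hp (hc i hi)) => p q r /=; lia.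
- move=> u v w.
  by apply: (restricted_mul_assoc _ _ _ hm hs hp hp hs) => p q r /=; lia.
(* If p > 0 and p + q = i, then r = q < i; so r >= i and p + q = i force p = 0. *)
- move=> i u v w hi; have hi' : (0 < i <= m)%N by lia.
  rewrite (succ_circ_tail _ _ hi').
  by apply: (restricted_mul_assoc _ _ _ hm hp (hc i hi) (tail_cond_spec hi') (hc i hi))
    => p q r /=; lia.
- move=> u v w; rewrite star.
  by apply: (restricted_mul_assoc _ _ _ hm ht hs hs hs) => p q r /=; lia.
(* When r = q = i, the bound p >= m - i is the same as p + q >= m; with p = 0 and r = i, the latter
   would give q >= m > r. *)
- move=> i u v w hi; have hi' : (0 < m - i <= m)%N by lia.
  rewrite (succ_circ_tail _ _ hi').
  by apply: (restricted_mul_assoc _ _ _ hm (tail_cond_spec hi') (hc i hi) (hc i hi) hs)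
    => p q r /=; lia.
(* For p = 0 the right-hand selection would give q = k + i > i = r, against q <= r; for p > 0, r =
   q. *)
- move=> k i u v w hk hi hki; have hki' : (1 <= k + i < m)%N by lia.
  by apply: (restricted_mul_assoc _ _ _ hm (hc k hk) (hc i hi) (hc i hi) (hc _ hki'))
    => p q r /=; lia.
Qed.
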